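(* Let $D$ be a weighted oriented graph with $V^+\neq\emptyset$ in which all elements of $V^+$ are sinks, let $I=I(D)$ be its edge ideal, and let $C_1,\dots,C_s$ be the strong vertex covers of $D$. Write $w_j=w(x_j)$ for $x_j\in V^+$. For each $i$ put $$I_{C_i}=\bigl(\{x_j : x_j\in C_i\setminus V^+\}\cup\{x_j^{w_j} : x_j\in C_i\cap V^+\}\bigr).$$ Then the irredundant irreducible decomposition of $I$ is $$I=I_{C_1}\cap\cdots\cap I_{C_s},$$ and for all $m\ge 1$ $$I^{(m)}=I_{C_1}^{m}\cap\cdots\cap I_{C_s}^{m}.$$ Moreover, for each $i$, $\mathrm{rad}(I_{C_i})=P_i=(C_i)$, the ideal generated by the variables in $C_i$, and the $P_i$ are minimal primes of $I$.
   Context: A weighted oriented graph $D=(V(D),E(D),w)$ consists of a finite simple graph $G$ (the underlying graph) on vertices $V(D)=\{x_1,\dots,x_n\}$, an orientation of each edge of $G$ (the pair $(x_i,x_j)\in E(D)$ denotes the edge directed from $x_i$ to $x_j$), and a weight function $w:V(D)\to\mathbb{N}=\{1,2,\dots\}$. If $x$ is a source (only arrows leaving $x$), one always assumes $w(x)=1$. Set $V^+=\{x\in V(D): w(x)\neq 1\}$. A vertex $x$ is a sink if all edges at $x$ are directed into $x$. Let $R=K[x_1,\dots,x_n]$ with $K$ a field (vertices are identified with variables). The edge ideal of $D$ is $I(D)=(x_ix_j^{w(x_j)} : (x_i,x_j)\in E(D))\subseteq R$. For a vertex $x$, $N_D^+(x)=\{y:(x,y)\in E(D)\}$ and $N_D^-(x)=\{y:(y,x)\in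 E(D)\}$. A vertex cover of $D$ is a subset $C\subseteq V(D)$ containing at least one endpoint of each edge. For a vertex cover $C$ with complement $C^c=V(D)\setminus C$, put $L_1(C)=\{x\in C: N_D^+(x)\cap C^c\neq\emptyset\}$, $L_2(C)=\{x\in C: x\notin L_1(C),\ N_D^-(x)\cap C^c\neq\emptyset\}$, $L_3(C)=C\setminus(L_1(C)\cup L_2(C))$. A vertex cover $C$ is strong if for each $x\in L_3(C)$ there is $(y,x)\in E(D)$ with $y\in L_2(C)\cup L_3(C)$ and $y\in V^+$. For a homogeneous ideal $I\subset R$, the $m$-th symbolic power is $I^{(m)}=\bigcap_{p\in \mathrm{Ass}(I)}(I^mR_p\cap R)$, the intersection being over all associated primes of $I$. *)

(* Defs.v *)
From HB Require Import structures.
From mathcomp Require Import all_boot all_order all_algebra.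
From mathcomp Require Import classical_sets.
From mathcomp Require Import mpoly.

Set Implicit Arguments.
Unset Strict Implicit.
Unset Printing Implicit Defensive.

Import GRing.Theory.

Local Open Scope classical_set_scope.
Local Open Scope ring_scope.

(* In this file [set _] is a classical (Prop-valued) set, used for ideals, and
   {set _} is a finite set, used for sets of vertices. *)

Section Ideals.
Variable R : comNzRingType.
Implicit Types (I J p S : set R) (f g : R).

Definition is_ideal I : Prop :=
  [/\ I 0, forall f g, I f -> I g -> I (f + g) & forall f g, I g -> I (f * g)].

Definition ideal_gen S : set R :=
  [set f | exists s : seq (R * R),
    (forall q, q \in s -> S q.2) /\ f = \sum_(q <- s) q.1 * q.2].

Definition ideal_mul I J : set R :=
  ideal_gen [set h | exists f g, [/\ I f, J g & h = f * g]].

Definition ideal_exp I m : set R := iter m (ideal_mul I) setT.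

Definition prime_ideal p : Prop :=
  [/\ is_ideal p, ~ p 1 & forall f g, p (f * g) -> p f \/ p g].

Definition radical I : set R := [set f | exists k : nat, I (f ^+ k)].

Definition minimal_prime I p : Prop :=
  [/\ prime_ideal p, I `<=` p &
      forall q, prime_ideal q -> I `<=` q -> q `<=` p -> q = p].

(* [g | g * f \in I] is the annihilator of the class of f in R/I. *)
Definition associated_prime I p : Prop :=
  prime_ideal p /\ exists f, p = [set g | I (g * f)].

Definition irreducible_ideal I : Prop :=
  [/\ is_ideal I, ~ I 1 &
      forall J1 J2, is_ideal J1 -> is_ideal J2 ->
        I = J1 `&` J2 -> I = J1 \/ I = J2].

Definition irredundant_irreducible_decomposition
    I (T : Type) (A : set T) (Q : T -> set R) : Prop :=
  [/\ forall a, A a -> irreducible_ideal (Q a),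
      I = \bigcap_(a in A) Q a &
      forall b, A b -> I <> \bigcap_(a in A `\ b) Q a].

End Ideals.

Section SymbolicPower.
Variable R : idomainType.
Implicit Types (I p : set R).

(* As R is a domain, R_p is a subring of its fraction field. *)
Definition localization p : set {fraction R} :=
  [set x | exists a s : R, ~ p s /\ x = tofrac a / tofrac s].

(* I R_p: the ideal of R_p generated by the image of I. *)
Definition localized_ideal I p : set {fraction R} :=
  [set x | exists l : seq ({fraction R} * R),
    (forall q, q \in l -> localization p q.1 /\ I q.2) /\
    x = \sum_(q <- l) q.1 * tofrac q.2].

Definition symbolic_power I m : set R :=
  \bigcap_(p in associated_prime I)
    [set f | localized_ideal (ideal_exp I m) p (tofrac f)].

End SymbolicPower.

Record wograph (n : nat) := WOGraph {
  arc : rel 'I_n;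
  weight : 'I_n -> nat;
  arc_irreflexive : irreflexive arc;
  arc_antisymmetric : forall x y, arc x y -> ~~ arc y x;
  weight_gt0 : forall x, (0 < weight x)%N;
  weight_source : forall x, (forall y, ~~ arc y x) -> weight x = 1%N
}.

Section Graphs.
Variables (n : nat) (D : wograph n).
Implicit Types (x y : 'I_n) (C : {set 'I_n}).

Definition Vplus : {set 'I_n} := [set x | weight D x != 1%N]%SET.

(* As in [weight_source], an isolated vertex is both a source and a sink. *)
Definition sink x : Prop := forall y, ~~ arc D x y.

Definition out_nbhd x : {set 'I_n} := [set y | arc D x y]%SET.
Definition in_nbhd x : {set 'I_n} := [set y | arc D y x]%SET.

Definition vertex_cover C : bool :=
  [forall x, forall y, arc D x y ==> (x \in C) || (y \in C)].

Definition L1 C : {set 'I_n} :=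
  [set x in C | out_nbhd x :&: ~: C != finset.set0]%SET.

Definition L2 C : {set 'I_n} :=
  [set x in C | (x \notin L1 C) && (in_nbhd x :&: ~: C != finset.set0)]%SET.

Definition L3 C : {set 'I_n} := (C :\: (L1 C :|: L2 C))%SET.

Definition strong_vertex_cover C : bool :=
  vertex_cover C &&
  [forall x in L3 C, exists y,
     [&& arc D y x, y \in (L2 C :|: L3 C)%SET & y \in Vplus]].

Variable K : fieldType.

Definition edge_ideal : set {mpoly K[n]} :=
  ideal_gen [set f | exists x y, arc D x y /\ f = 'X_x * 'X_y ^+ weight D y].

Definition cover_ideal C : set {mpoly K[n]} :=
  ideal_gen ([set f | exists x, x \in (C :\: Vplus)%SET /\ f = 'X_x] `|`
             [set f | exists x, x \in (C :&: Vplus)%SET /\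
                                f = 'X_x ^+ weight D x]).

End Graphs.

Definition variables_ideal (n : nat) (K : fieldType) (C : {set 'I_n}) :
    set {mpoly K[n]} :=
  ideal_gen [set f | exists x, x \in C /\ f = 'X_x].

Arguments edge_ideal {n} D K.
Arguments cover_ideal {n} D K C.
Arguments variables_ideal {n} K C.

(* Main.v *)
Require Import Defs.
From HB Require Import structures.
From mathcomp Require Import all_boot all_order all_algebra.
From mathcomp Require Import boolp classical_sets.
From mathcomp Require Import mpoly ring.

(* As the vertices of [V^+] are sinks, the strong vertex covers are exactly the
   minimal vertex covers. An ideal [Q] generated by powers [x_i ^ a_i], [i \in C],
   is irreducible, and each [Q^k] is a monomial ideal involving only the variables
   of [C], hence primary to the prime [P] generated by these variables. A monomial
   outside the edge ideal [I] has exponents below the weights on a vertex cover,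
   which gives [I = \bigcap_C I_C]; thus the associated primes of [I] are the
   primes [P_C], one for each minimal cover. A vertex of a minimal cover [C] has a
   neighbour outside [C], and that variable is a unit locally at [P_C]; therefore
   [I] and [I_C] agree locally at [P_C], and so do their powers. *)

Set Implicit Arguments.
Unset Strict Implicit.
Unset Printing Implicit Defensive.

Import GRing.Theory.

Local Open Scope classical_set_scope.
Local Open Scope ring_scope.

(** * Tools for minimal-degree arguments *)

Lemma exists_minimizer (T : eqType) (r : seq T) (P : pred T) (d : T -> nat) x :
  x \in r -> P x -> exists y, [/\ y \in r, P y &
    forall z, z \in r -> P z -> (d y <= d z)%N].
Proof.
move=> xr Px; pose E k := has (fun y => P y && (d y == k)) r.
have exE : exists k, E k by exists (d x); apply/hasP; exists x; rewrite ?Px /=.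
case: (ex_minnP exE) => k /hasP[y yr /andP[Py /eqP yk]] kmin.
exists y; split=> // z zr Pz; rewrite yk; apply: kmin.
by apply/hasP; exists z; rewrite ?Pz /=.
Qed.

(** Used with [c] the exponents of a monomial of minimal degree in the variables of [C]: a
    competitor dominated by it on [C] must agree with it there. *)
Lemma eq_in_sum_leq (T : finType) (C : {pred T}) (b c : T -> nat) :
  (forall i, i \in C -> (b i <= c i)%N) ->
  (\sum_(i in C) c i <= \sum_(i in C) b i)%N ->
  forall i, i \in C -> b i = c i.
Proof.
move=> bc cb.
have [le_bc eq_bc] := leqif_sum (fun i iC => leqif_eq (bc i iC)).
by move: eq_bc; rewrite eqn_leq le_bc cb => /esym/forall_inP bcE i /bcE/eqP.
Qed.

(** * Generated ideals, their powers and saturations *)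

Section Ideals.
Variable R : comNzRingType.
Implicit Types (I J p S : set R) (f g : R).

Lemma ideal_gen_is_ideal S : is_ideal (ideal_gen S).
Proof.
split; first by exists [::]; split => //; rewrite big_nil.
- move=> f g [s [Ss ->]] [t [St ->]]; exists (s ++ t); split.
    by move=> q; rewrite mem_cat => /orP[/Ss|/St].
  by rewrite big_cat.
- move=> f g [s [Ss ->]]; exists [seq (f * q.1, q.2) | q <- s]; split.
    by move=> q /mapP[r /Ss Sr ->].
  by rewrite big_map mulr_sumr; apply: eq_bigr => q _; rewrite mulrA.
Qed.

Lemma mem_ideal_gen S g : S g -> ideal_gen S g.
Proof.
move=> Sg; exists [:: (1, g)]; split; last by rewrite big_seq1 mul1r.
by move=> q; rewrite inE => /eqP->.
Qed.

Lemma ideal_sum I (T : eqType) (r : seq T) (P : pred T) (F : T -> R) :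
  is_ideal I -> (forall i, i \in r -> P i -> I (F i)) ->
  I (\sum_(i <- r | P i) F i).
Proof.
move=> [I0 ID _] IF; rewrite big_seq_cond.
by elim/big_ind: _ => // i /andP[]; apply: IF.
Qed.

Lemma ideal_gen_sub S I : is_ideal I -> S `<=` I -> ideal_gen S `<=` I.
Proof.
move=> idI SI f [s [Ss ->]]; apply: ideal_sum => // q /Ss/SI Iq _.
by case: idI => _ _; apply.
Qed.

Lemma ideal_mulr I f g : is_ideal I -> I f -> I (f * g).
Proof. by case=> _ _ IM If; rewrite mulrC; apply: IM. Qed.

Lemma ideal_sub I f g : is_ideal I -> I f -> I g -> I (f - g).
Proof.
by move=> [_ ID IM] If Ig; apply: ID => //; rewrite -mulN1r; apply: IM.
Qed.

Lemma mem_ideal_mul I J f g : I f -> J g -> ideal_mul I J (f * g).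
Proof. by move=> If Jg; apply: mem_ideal_gen; exists f, g. Qed.

Lemma ideal_exp_is_ideal I m : is_ideal (ideal_exp I m).
Proof. by case: m => [|m]; [split | apply: ideal_gen_is_ideal]. Qed.

Lemma ideal_exp1 I : is_ideal I -> ideal_exp I 1 = I.
Proof.
move=> idI; apply/seteqP; split => f.
  apply: ideal_gen_sub => // _ [g [h [Ig _ ->]]].
  exact: ideal_mulr.
by move=> If; rewrite -[f]mulr1; apply: mem_ideal_mul.
Qed.

Lemma ideal_expS I J m : I `<=` J -> ideal_exp I m `<=` ideal_exp J m.
Proof.
move=> IJ; elim: m => //= m IHm.
apply: ideal_gen_sub; first exact: ideal_gen_is_ideal.
by move=> _ [f [g [/IJ Jf /IHm Jg ->]]]; apply: mem_ideal_mul.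
Qed.

Lemma mem_ideal_exp I m f : I f -> ideal_exp I m (f ^+ m).
Proof.
by move=> If; elim: m => //= m IHm; rewrite exprS; apply: mem_ideal_mul.
Qed.

Lemma prime_ideal_exp p f m : prime_ideal p -> p (f ^+ m) -> p f.
Proof.
move=> [_ p1 pM]; elim: m => [|m IHm]; first by rewrite expr0.
by rewrite exprS => /pM[|/IHm].
Qed.

(** This set is the contraction of I R_p to R; knowing that it is an ideal lets inclusions into it
    be tested on generators. *)
Lemma saturation_is_ideal p I : prime_ideal p -> is_ideal I ->
  is_ideal [set f | exists t, ~ p t /\ I (t * f)].
Proof.
move=> [_ p1 pM] [I0 ID IM]; split=> [|f g [t [pt It]] [u [pu Iu]]|f g [t [pt It]]].
- by exists 1; rewrite mulr0.
- exists (t * u); split; first by case/pM.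
  rewrite mulrDr; apply: ID; first by rewrite mulrAC mulrC; apply: IM.
  by rewrite -mulrA; apply: IM.
- by exists t; split=> //; rewrite mulrCA; apply: IM.
Qed.

(* The hypothesis says [I R_p] contains [J], whence [I^m R_p] contains [J^m]. *)
Lemma ideal_exp_saturation p I J m : prime_ideal p -> is_ideal I ->
  J `<=` [set f | exists t, ~ p t /\ I (t * f)] ->
  ideal_exp J m `<=` [set f | exists t, ~ p t /\ ideal_exp I m (t * f)].
Proof.
move=> pr_p idI JI; have [_ p1 pM] := pr_p.
elim: m => [|m IHm]; first by move=> f _; exists 1.
apply: ideal_gen_sub.
  exact: saturation_is_ideal pr_p (ideal_exp_is_ideal I m.+1).
move=> _ [g [h [/JI[t [pt It]] /IHm[u [pu Iu]] ->]]].
exists (t * u); split; first by case/pM.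
by rewrite mulrACA; apply: mem_ideal_mul.
Qed.

End Ideals.

(** * Membership in localized ideals *)

Section Localization.
Variable R : idomainType.

(** Denominators are cleared by induction on the sum, their product staying outside the prime [p].
    As [R] is a domain, the resulting identity of fractions already holds in [R]. *)
Lemma localized_idealP (p J : set R) (f : R) : prime_ideal p -> is_ideal J ->
  localized_ideal J p (tofrac f) <-> exists t, ~ p t /\ J (t * f).
Proof.
move=> [[p0 _ _] p1 pM] idJ.
have frac_neq0 t : ~ p t -> tofrac t != 0.
  by move=> pt; rewrite tofrac_eq0; apply: contra_notN pt => /eqP->.
split=> [[l [Jl fE]]|[t [pt Jt]]].
  suff [t [g [pt Jg tE]]] : exists t g, [/\ ~ p t, J g &
      tofrac t * (\sum_(q <- l) q.1 * tofrac q.2) = tofrac g].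
    exists t; split => //; rewrite (_ : t * f = g) //.
    by apply/eqP; rewrite -tofrac_eq tofracM fE tE.
  elim: l Jl {fE} => [|q l IHl] Jl.
    exists 1, 0; split => //; first by case: idJ.
    by rewrite big_nil mulr0 tofrac0.
  have [|t [g [pt Jg tE]]] := IHl.
    by move=> r rl; apply: Jl; rewrite inE rl orbT.
  have [[a [s [ps qE]]] Jq] := Jl q (mem_head _ _).
  exists (s * t), (t * a * q.2 + s * g); split.
  - by case/pM.
  - by case: idJ => _ ID IM; apply: ID; apply: IM.
  rewrite big_cons mulrDr !tofracM -[in X in _ + X]mulrA tE.
  by rewrite tofracD !tofracM qE; field; apply: frac_neq0.
exists [:: (tofrac 1 / tofrac t, t * f)]; split.
  by move=> q; rewrite inE => /eqP->; split => //; exists 1, t.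
by rewrite big_seq1 /= tofrac1 tofracM mul1r mulKf ?frac_neq0.
Qed.

End Localization.

(** * Monomial supports and ideals generated by powers of variables *)

Section MonomialIdeals.
Variables (n : nat) (K : fieldType).
Implicit Types (C : {set 'I_n}) (a : 'I_n -> nat) (m : 'X_{1..n}).
Implicit Types (f g s : {mpoly K[n]}).

Definition mproj (P : pred 'X_{1..n}) f : {mpoly K[n]} :=
  \sum_(m <- msupp f | P m) f@_m *: 'X_[m].

Lemma mcoeff_mproj P f m : (mproj P f)@_m = if P m then f@_m else 0.
Proof.
rewrite /mproj raddf_sum /=.
under eq_bigr do rewrite mcoeffZ mcoeffX.
have [mf|mf] := boolP (m \in msupp f); last first.
  rewrite (memN_msupp_eq0 mf) if_same big_seq_cond big1 // => k /andP[kf _].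
  by case: eqP kf mf => [-> ->|]; rewrite ?mulr0.
rewrite -big_filter; case: ifP => Pm.
  rewrite (bigD1_seq m) ?filter_uniq ?msupp_uniq ?mem_filter ?Pm //=.
  rewrite eqxx mulr1 big1 ?addr0 // => k /negbTE->.
  by rewrite mulr0.
rewrite big_seq big1 // => k; rewrite mem_filter => /andP[Pk _].
by case: eqP Pk => [->|]; rewrite ?Pm ?mulr0.
Qed.

Lemma msupp_mproj P f m : (m \in msupp (mproj P f)) = P m && (m \in msupp f).
Proof. by rewrite !mcoeff_msupp mcoeff_mproj; case: (P m); rewrite ?eqxx. Qed.

Lemma mproj_split P f : f = mproj P f + mproj (predC P) f.
Proof.
apply/mpolyP => m; rewrite mcoeffD !mcoeff_mproj /=.
by case: (P m); rewrite /= ?addr0 ?add0r.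
Qed.

Lemma msuppM_ex f g m : m \in msupp (f * g) ->
  exists m1 m2, [/\ m1 \in msupp f, m2 \in msupp g & m = (m1 + m2)%MM].
Proof.
by move=> /msuppM_le/allpairsP[[m1 m2] /= [? ? ->]]; exists m1, m2.
Qed.

Lemma mpoly_ex_msupp f : f != 0 -> exists m, m \in msupp f.
Proof.
rewrite -msupp_eq0; case: (msupp f) => // m r _.
by exists m; rewrite mem_head.
Qed.

Definition pure_power_ideal C a : set {mpoly K[n]} :=
  ideal_gen [set f | exists x, x \in C /\ f = 'X_x ^+ a x].

Lemma pure_power_ideal_is_ideal C a : is_ideal (pure_power_ideal C a).
Proof. exact: ideal_gen_is_ideal. Qed.

(** The sum counts the generators, with multiplicity, that can be split off the monomial. Splitting
    off one lowers the count by exactly one, which drives the induction. *)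
Lemma monomial_exp_pure_power C a k m :
  (k <= \sum_(i in C) m i %/ a i)%N ->
  ideal_exp (pure_power_ideal C a) k 'X_[m].
Proof.
elim: k m => [|k IHk] m //= km.
have [i iC im] : exists2 i, i \in C & (0 < m i %/ a i)%N.
  apply/exists_inP; apply: contraLR km => /exists_inPn mC.
  by rewrite big1 // => i /mC; rewrite lt0n negbK => /eqP.
have ai : (0 < a i)%N by case: (a i) im => //; rewrite divn0.
have aim : (a i <= m i)%N by rewrite -[a i]mul1n -leq_divRL.
pose u : 'X_{1..n} := (U_(i) *+ a i)%MM.
have um : (u <= m)%MM.
  apply/mnm_lepP => j; rewrite mulmnE mnm1E.
  by case: eqP => [<-|_]; rewrite ?mul1n.
rewrite -(submK um) addmC mpolyXD -mpolyXn; apply: mem_ideal_mul.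
  by apply: mem_ideal_gen; exists i.
apply: IHk; rewrite (bigD1 i) //= in km; rewrite (bigD1 i) //=.
rewrite mnmBE mulmnE mnm1E eqxx mul1n.
rewrite -{1}(subnK aim) divnDr ?dvdnn // divnn ai addn1 addSn ltnS in km.
apply: leq_trans km _; rewrite leq_add2l; apply/eq_leq/eq_bigr => j /andP[_ ji].
by rewrite mnmBE mulmnE mnm1E eq_sym (negbTE ji) subn0.
Qed.

(** For the forward direction, floor division is superadditive: polynomials whose monomials all have
    count at least [j] form an ideal, and counts at least add up in products. *)
Lemma mem_exp_pure_power C a k f : (forall i, 0 < a i)%N ->
  ideal_exp (pure_power_ideal C a) k f <->
  forall m, m \in msupp f -> (k <= \sum_(i in C) m i %/ a i)%N.
Proof.
move=> a_gt0; split; last first.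
  move=> kf; rewrite [f]mpolyE; apply: ideal_sum => [|m mf _].
    exact: ideal_exp_is_ideal.
  rewrite -mul_mpolyC; have [_ _ IM] := ideal_exp_is_ideal (pure_power_ideal C a) k.
  by apply: IM; apply: monomial_exp_pure_power; apply: kf.
pose mono j := [set g : {mpoly K[n]} | forall m, m \in msupp g ->
  (j <= \sum_(i in C) m i %/ a i)%N].
have superadd m1 m2 : (\sum_(i in C) m1 i %/ a i + \sum_(i in C) m2 i %/ a i <=
    \sum_(i in C) (m1 + m2)%MM i %/ a i)%N.
  rewrite -big_split; apply: leq_sum => i _ /=.
  by rewrite mnmDE divnD ?leq_addr.
have mono_ideal j : is_ideal (mono j).
  split=> [m|g h Mg Mh m|g h Mh m].
  - by rewrite msupp0.
  - by move=> /msuppD_le; rewrite mem_cat => /orP[/Mg|/Mh].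
  - move=> /msuppM_ex[m1 [m2 [_ /Mh m2h ->]]].
    exact: leq_trans m2h (leq_trans (leq_addl _ _) (superadd _ _)).
rewrite -/(mono k f); elim: k f => [|k IHk] f //=.
apply: (ideal_gen_sub (mono_ideal k.+1)) => _ [g [h [Ig Ih ->]]] m.
move=> /msuppM_ex[m1 [m2 [m1g m2h ->]]].
apply: leq_trans (superadd _ _); rewrite -add1n leq_add ?(IHk h) //.
suff /(_ g Ig m1 m1g) : pure_power_ideal C a `<=` mono 1 by [].
apply: ideal_gen_sub (mono_ideal 1%N) _ => _ [x [xC ->]] m'.
rewrite mpolyXn msuppX inE => /eqP->.
by rewrite (bigD1 x) //= mulmnE mnm1E eqxx mul1n divnn a_gt0.
Qed.

Lemma mem_pure_power C a f : (forall i, 0 < a i)%N ->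
  pure_power_ideal C a f <->
  forall m, m \in msupp f -> exists2 i, i \in C & (a i <= m i)%N.
Proof.
move=> a_gt0.
rewrite -(ideal_exp1 (@pure_power_ideal_is_ideal C a)) mem_exp_pure_power //.
suff mP m : (0 < \sum_(i in C) m i %/ a i)%N <->
    exists2 i, i \in C & (a i <= m i)%N.
  by split=> fP m mf; apply/mP; apply: fP.
rewrite lt0n sum_nat_eq0 negb_forall_in; split.
  move=> /exists_inP[i iC im]; exists i => //.
  by rewrite -[a i]mul1n -leq_divRL // lt0n.
move=> [i iC im]; apply/exists_inP; exists i => //.
by rewrite -lt0n leq_divRL // mul1n.
Qed.

Lemma variables_idealE C :
  variables_ideal K C = pure_power_ideal C (fun=> 1%N).
Proof. by rewrite /variables_ideal; congr ideal_gen. Qed.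

Lemma mem_variables_ideal C f : variables_ideal K C f <->
  forall m, m \in msupp f -> exists2 i, i \in C & (0 < m i)%N.
Proof. by rewrite variables_idealE mem_pure_power. Qed.

(* Grading by the exponents of the variables in [C], the component of [s * f] in
   a minimal degree of [f] outside the ideal is the product of the degree 0
   component of [s] with a component of [f]; both are nonzero. *)
Lemma pure_power_primary C a k s f : (forall i, 0 < a i)%N ->
  ~ variables_ideal K C s ->
  ideal_exp (pure_power_ideal C a) k (s * f) ->
  ideal_exp (pure_power_ideal C a) k f.
Proof.
move=> a_gt0 sP; rewrite !mem_exp_pure_power // => sfk m mf.
rewrite leqNgt; apply/negP => m_bad.
pose bad (m : 'X_{1..n}) := (\sum_(i in C) m i %/ a i < k)%N.
have [m0 [m0f m0_bad m0_min]] := exists_minimizer (P := bad)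
  (fun m : 'X_{1..n} => \sum_(i in C) m i)%N mf m_bad.
pose P0 : pred 'X_{1..n} := fun m => [forall i in C, m i == 0%N].
pose Pc : pred 'X_{1..n} := fun m => [forall i in C, m i == m0 i].
pose s0 := mproj P0 s; pose f0 := mproj Pc f.
have s0_neq0 : s0 != 0.
  apply: contra_notN sP => /eqP s0_eq0; apply/mem_variables_ideal => l ls.
  have : l \notin msupp s0 by rewrite s0_eq0 msupp0.
  rewrite msupp_mproj ls andbT => /forall_inPn[i iC li].
  by exists i => //; rewrite lt0n.
have f0_neq0 : f0 != 0.
  apply/eqP => f0_eq0.
  have : m0 \in msupp f0.
    by rewrite msupp_mproj m0f andbT; apply/forall_inP.
  by rewrite f0_eq0 msupp0.
have [l lsf0] := mpoly_ex_msupp (mulf_neq0 s0_neq0 f0_neq0).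
have lE i : i \in C -> l i = m0 i.
  have [m1 [m2 []]] := msuppM_ex lsf0.
  rewrite !msupp_mproj => /andP[/forall_inP m1P _] /andP[/forall_inP m2P _] ->.
  by move=> iC; rewrite mnmDE (eqP (m1P i iC)) (eqP (m2P i iC)).
suff /sfk : l \in msupp (s * f).
  rewrite (eq_bigr (fun i => m0 i %/ a i)%N) => [|i /lE->//].
  by move/(leq_trans m0_bad); rewrite ltnn.
have -> : s * f = s0 * f0 + (mproj (predC P0) s * f0 + s * mproj (predC Pc) f).
  by rewrite addrA -mulrDl -mproj_split -mulrDr -mproj_split.
rewrite mcoeff_msupp mcoeffD mcoeffD.
rewrite [X in _ + (X + _)]memN_msupp_eq0 ?[X in _ + (_ + X)]memN_msupp_eq0.
- by rewrite !addr0 -mcoeff_msupp.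
(* On [C], [k2] is at most [l], which equals [m0] there, so [k2] is bad as well; minimality of [m0]
   forces equality on [C], contrary to the choice of [k2]. *)
- apply/negP => /msuppM_ex[k1 [k2 [_ k2f lD]]].
  move: k2f; rewrite msupp_mproj => /andP[/forall_inP k2N k2f]; apply: k2N.
  have k2_le i : i \in C -> (k2 i <= m0 i)%N.
    by move=> /lE <-; rewrite lD mnmDE leq_addl.
  have k2_bad : bad k2.
    by apply: leq_ltn_trans m0_bad; apply: leq_sum => i /k2_le; apply: leq_div2r.
  by move=> i iC; rewrite (eq_in_sum_leq k2_le (m0_min _ k2f k2_bad)).
(* Here [k2] equals [m0], hence [l], on [C], which leaves no variable of [C] for [k1]. *)
- apply/negP => /msuppM_ex[k1 [k2 []]]; rewrite !msupp_mproj => /andP[/negP k1N _].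
  move=> /andP[/forall_inP k2c _] lD; apply/k1N/forall_inP => i iC.
  by move: (lE i iC); rewrite lD mnmDE (eqP (k2c i iC)) => /eqP;
    rewrite -{2}[m0 i]add0n eqn_add2r.
Qed.

Lemma pure_power_primary1 C a s f : (forall i, 0 < a i)%N ->
  ~ variables_ideal K C s ->
  pure_power_ideal C a (s * f) -> pure_power_ideal C a f.
Proof.
move=> a_gt0 sP; rewrite -(ideal_exp1 (@pure_power_ideal_is_ideal C a)).
exact: pure_power_primary.
Qed.

Lemma pure_power_proper C a : (forall i, 0 < a i)%N -> ~ pure_power_ideal C a 1.
Proof.
move=> a_gt0 /mem_pure_power -/(_ a_gt0 0%MM).
rewrite -mpolyC1 msupp1 mem_head => /(_ isT)[i _].
by rewrite mnm0E leqNgt a_gt0.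
Qed.

Lemma variables_ideal_prime C : prime_ideal (variables_ideal K C).
Proof.
split; first exact: ideal_gen_is_ideal.
  by rewrite variables_idealE; apply: pure_power_proper.
move=> f g fg; have [|fP] := pselect (variables_ideal K C f); first by left.
by right; move: fg; rewrite !variables_idealE; apply: pure_power_primary1.
Qed.

(** The largest monomial in the variables of [C] outside the ideal: it spans the socle of the
    quotient of K[x_i : i in C] by the powers x_i^(a_i). *)
Definition socle_monomial C a : 'X_{1..n} :=
  [multinom if i \in C then (a i).-1 else 0%N | i < n].

Lemma socle_monomialN C a : (forall i, 0 < a i)%N ->
  ~ pure_power_ideal C a 'X_[socle_monomial C a].
Proof.
move=> a_gt0 /mem_pure_power -/(_ a_gt0 (socle_monomial C a)).
rewrite msuppX mem_head => /(_ isT)[i iC].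
by rewrite mnmE iC leqNgt ltn_predL a_gt0.
Qed.

(** Among the monomials of [f] outside the ideal, take [m0] of least degree in the variables of [C],
    and multiply [f] by the monomial lifting the [C]-part of [m0] to the socle. The terms sharing
    this [C]-part give [g] times the socle monomial; all other terms fall into the ideal. *)
Lemma socle_multiple C a f : (forall i, 0 < a i)%N ->
  ~ pure_power_ideal C a f -> exists u g, ~ variables_ideal K C g /\
    pure_power_ideal C a (u * f - g * 'X_[socle_monomial C a]).
Proof.
move=> a_gt0 fN.
pose good (m : 'X_{1..n}) := [forall i in C, m i < a i]%N.
have [m mf m_good] : exists2 m, m \in msupp f & good m.
  apply: contrapT => fP; apply/fN/mem_pure_power => // m mf.
  apply/exists_inP; apply: contra_notT fP => /exists_inPn mN.
  by exists m => //; apply/forall_inP => i /mN; rewrite ltnNge.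
have [m0 [m0f /forall_inP m0_good m0_min]] := exists_minimizer
  (fun m : 'X_{1..n} => \sum_(i in C) m i)%N mf m_good.
pose Pc : pred 'X_{1..n} := fun m => [forall i in C, m i == m0 i].
pose r (m : 'X_{1..n}) : 'X_{1..n} :=
  [multinom if i \in C then 0%N else m i | i < n].
pose u : 'X_{1..n} :=
  [multinom if i \in C then ((a i).-1 - m0 i)%N else 0%N | i < n].
have uE i : i \in C -> u i = ((a i).-1 - m0 i)%N by move=> iC; rewrite mnmE iC.
have m0_le i : i \in C -> (m0 i <= (a i).-1)%N.
  by move=> /m0_good m0a; rewrite -ltnS prednK.
pose g : {mpoly K[n]} := \sum_(m <- msupp f | Pc m) f@_m *: 'X_[r m].
have Pc_m0 : Pc m0 by apply/forall_inP.
(* Stripping the variables of [C] is injective on monomials with the same [C]-part, so no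
   coefficients cancel. *)
have g_m0 : g@_(r m0) = f@_m0.
  rewrite /g raddf_sum -big_filter (bigD1_seq m0) ?filter_uniq ?msupp_uniq //=;
    last by rewrite mem_filter Pc_m0.
  rewrite mcoeffZ mcoeffX eqxx mulr1 big_seq_cond big1 ?addr0 // => l.
  rewrite mem_filter mcoeffZ mcoeffX => /andP[/andP[/forall_inP lc _] lm0].
  case: eqP => [rE|]; last by rewrite mulr0.
  case/eqP: lm0; apply/mnmP => i; have [iC|iC] := boolP (i \in C).
    exact/eqP/lc.
  by have := congr1 (fun k : 'X_{1..n} => k i) rE; rewrite !mnmE (negbTE iC).
exists 'X_[u], g; split.
  move=> /mem_variables_ideal/(_ (r m0)); rewrite mcoeff_msupp g_m0 -mcoeff_msupp.
  by case/(_ m0f) => i iC; rewrite mnmE iC.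
have gE : g * 'X_[socle_monomial C a] = 'X_[u] * mproj Pc f.
  rewrite mulr_suml mulr_sumr; apply: eq_bigr => l /forall_inP lc.
  rewrite -scalerAl -scalerAr -!mpolyXD; congr (_ *: 'X_[_]).
  apply/mnmP => i; rewrite !mnmDE !mnmE; case: ifP => iC; last exact: addnC.
  by rewrite (eqP (lc i iC)) add0n subnK ?m0_le.
rewrite gE {1}(mproj_split Pc f) mulrDr addrC addKr.
apply/mem_pure_power => // l /msuppM_ex[l1 [l2 []]].
rewrite msuppX inE => /eqP-> l2f ->; move: l2f.
rewrite msupp_mproj => /andP[/negP l2N l2f].
apply/exists_inP; apply: contra_notT l2N => /exists_inPn lN; apply/forall_inP.
(* If [u + l2] stays below [a] on [C], then [l2] is at most [m0] there, and minimality gives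
   equality. *)
have l2_le i : i \in C -> (l2 i <= m0 i)%N.
  move=> iC; have := lN i iC; rewrite -ltnNge mnmDE uE //.
  rewrite -[X in (_ < X)%N](prednK (a_gt0 i)) ltnS.
  by rewrite -[X in (_ <= X)%N -> _](subnK (m0_le i iC)) leq_add2l.
have l2_good : good l2.
  by apply/forall_inP => i iC; apply: leq_ltn_trans (l2_le i iC) (m0_good i iC).
by move=> i iC; rewrite (eq_in_sum_leq l2_le (m0_min _ l2f l2_good)).
Qed.

(* Two ideals properly containing [q := pure_power_ideal C a] contain [g * x] and
   [h * x] for the socle monomial [x] and some [g], [h] that are nonzero divisors
   modulo [q], so their intersection contains [g * h * x], which is not in [q]. *)
Lemma pure_power_irreducible C a : (forall i, 0 < a i)%N ->
  irreducible_ideal (pure_power_ideal C a).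
Proof.
move=> a_gt0; split; [exact: ideal_gen_is_ideal | exact: pure_power_proper |].
set q := pure_power_ideal C a; set x := 'X_[socle_monomial C a] : {mpoly K[n]}.
have mult J : is_ideal J -> q `<=` J -> q <> J ->
    exists g, ~ variables_ideal K C g /\ J (g * x).
  move=> idJ qJ neq_qJ.
  have [f Jf fq] : exists2 f, J f & ~ q f.
    apply: contrapT => JN; apply: neq_qJ; apply/seteqP; split=> // f Jf.
    by apply: contrapT => fq; apply: JN; exists f.
  have [u [g [gN ug]]] := socle_multiple a_gt0 fq.
  exists g; split => //; rewrite -[g * x](subKr (u * f)).
  apply: ideal_sub => //; last exact: qJ.
  by case: idJ => _ _; apply.
move=> J1 J2 id1 id2 qE; apply: contrapT => /not_orP[q1 q2].
have [|g [gN gx]] := mult J1 id1 _ q1; first by rewrite qE; apply: subIsetl.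
have [|h [hN hx]] := mult J2 id2 _ q2; first by rewrite qE; apply: subIsetr.
apply: (@socle_monomialN C a a_gt0); rewrite -/x.
apply: (pure_power_primary1 a_gt0 hN); apply: (pure_power_primary1 a_gt0 gN).
rewrite -/q qE; split; last by case: id2 => _ _; apply.
by rewrite mulrCA; case: id1 => _ _; apply.
Qed.

Lemma radical_pure_power C a : (forall i, 0 < a i)%N ->
  radical (pure_power_ideal C a) = variables_ideal K C.
Proof.
move=> a_gt0; apply/seteqP; split=> f.
  move=> [k fk]; apply: (@prime_ideal_exp _ _ _ k (variables_ideal_prime C)).
  apply/mem_variables_ideal => m; move/mem_pure_power: fk => /(_ a_gt0) /[apply].
  by case=> i iC im; exists i => //; apply: leq_trans im.
(* Pigeonhole: a monomial whose degree in the variables of [C] exceeds the sum of the [a i] has an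
   exponent reaching its [a i]. *)
move=> /(mem_ideal_exp (\sum_(i in C) a i).+1).
rewrite variables_idealE mem_exp_pure_power // => fP.
exists (\sum_(i in C) a i).+1; apply/mem_pure_power => // m /fP.
move=> sum_lt; apply/exists_inP; apply: contraLR sum_lt => /exists_inPn mN.
rewrite -leqNgt; apply: leq_sum => i /mN.
by rewrite divn1 -ltnNge => /ltnW.
Qed.

End MonomialIdeals.

Arguments pure_power_ideal {n} K C a.

(* [arc] would otherwise be the function of [mathcomp.boot.path]. *)
Local Notation arc := Defs.arc.

(** * Strong covers and edge ideals when the vertices of [Vplus] are sinks *)

Section EdgeIdeal.
Variables (K : fieldType) (n : nat) (D : wograph n).
Hypothesis Vplus_sinks : forall x : 'I_n, x \in Vplus D -> sink D x.
Implicit Types (x y : 'I_n) (C : {set 'I_n}).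

Lemma weight_tail x y : arc D x y -> weight D x = 1%N.
Proof.
move=> xy; apply/eqP; apply: contraTT xy => wx.
by apply: Vplus_sinks; rewrite inE.
Qed.

Lemma cover_idealE C : cover_ideal D K C = pure_power_ideal K C (weight D).
Proof.
congr ideal_gen; apply/seteqP; split=> f.
  case=> -[x [xC ->]]; exists x; move: xC; rewrite !inE => /andP[].
    by rewrite negbK => /eqP-> xC.
  by [].
move=> [x [xC ->]]; have [wx|wx] := eqVneq (weight D x) 1%N.
  by left; exists x; rewrite !inE wx xC.
by right; exists x; rewrite !inE wx xC.
Qed.

(* Arrows never leave [V^+], so strong means [L3 C] is empty, that is, [C] is a
   minimal vertex cover. *)
Lemma strong_vertex_coverP C : strong_vertex_cover D C <->
  vertex_cover D C /\
  forall x, x \in C -> exists2 y, y \notin C & arc D x y || arc D y x.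
Proof.
split=> [/andP[covC /forall_inP L3C]|[covC nbr]].
  split=> // x xC.
  have [|xL1] := boolP (x \in L1 D C).
    rewrite inE xC => /set0Pn[y]; rewrite !inE => /andP[xy yC].
    by exists y; rewrite ?xy.
  have [|xL2] := boolP (x \in L2 D C).
    rewrite inE xC xL1 => /set0Pn[y]; rewrite !inE => /andP[yx yC].
    by exists y; rewrite ?yx ?orbT.
  have /existsP[y /and3P[yx _ /Vplus_sinks/(_ x)]] : [exists y, [&& arc D y x,
      y \in (L2 D C :|: L3 D C)%SET & y \in Vplus D]].
    by apply: L3C; rewrite finset.in_setD finset.in_setU negb_or xL1 xL2.
  by rewrite yx.
apply/andP; split=> //; apply/forall_inP => x.
rewrite finset.in_setD finset.in_setU negb_or => /andP[/andP[xL1 xL2] xC].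
have [y yC /orP[xy|yx]] := nbr x xC.
  case/negP: xL1; rewrite inE xC; apply/set0Pn; exists y.
  by rewrite !inE xy yC.
case/negP: xL2; rewrite inE xC xL1; apply/set0Pn; exists y.
by rewrite !inE yx yC.
Qed.

Lemma vertex_coverP C : reflect
  (forall x y, arc D x y -> (x \in C) || (y \in C)) (vertex_cover D C).
Proof.
apply: (iffP forallP) => [cov x y|cov x].
  by move/forallP: (cov x) => /(_ y)/implyP.
by apply/forallP => y; apply/implyP/cov.
Qed.

(** Pass to an inclusion-minimal cover [B]: if some [x] in [B] had all its neighbours in [B], then
    [B] without [x] would still be a cover. *)
Lemma strong_cover_subset C : vertex_cover D C ->
  exists2 B : {set 'I_n}, strong_vertex_cover D B & B \subset C.
Proof.
move=> /(minset_exists (P := vertex_cover D))[B /minsetP[covB minB] BC].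
exists B => //; apply/strong_vertex_coverP; split=> // x xB.
apply: contrapT => xN.
have nbr y : arc D x y || arc D y x -> y \in (B :\ x)%SET.
  move=> xy; rewrite in_setD1; apply/andP; split.
    by apply: contraTneq xy => ->; rewrite arc_irreflexive.
  by apply/negPn/negP => yB; apply: xN; exists y.
have /minB BxB : vertex_cover D (B :\ x)%SET.
  apply/vertex_coverP => u v uv; have /orP[uB|vB] := vertex_coverP _ covB _ _ uv.
    have [ux|ux] := eqVneq u x; last by rewrite in_setD1 ux uB.
    by rewrite (nbr v) ?orbT // -ux uv.
  have [vx|vx] := eqVneq v x; last by rewrite [v \in _]in_setD1 vx vB orbT.
  by rewrite (nbr u) // -vx uv orbT.
by move: xB; rewrite -BxB ?subD1set // in_setD1 eqxx.
Qed.

(** If [B] lay inside [C], each vertex of [C] would have a neighbour outside [C], hence outside [B],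
    and covering that edge would force the vertex into [B]. *)
Lemma strong_cover_diff B C : strong_vertex_cover D B ->
  strong_vertex_cover D C -> B <> C -> exists2 x, x \in B & x \notin C.
Proof.
move=> /strong_vertex_coverP[/vertex_coverP covB _].
move=> /strong_vertex_coverP[_ nbrC] neqBC.
apply/subsetPn/negP => BC; apply/neqBC/eqP; rewrite finset.eqEsubset BC /=.
apply/fintype.subsetP => x /nbrC[y yC].
have yB : y \notin B by apply: contra yC; apply: (fintype.subsetP BC).
by case/orP => /covB; rewrite (negbTE yB) ?orbF.
Qed.

(** * Decomposition and associated primes of the edge ideal *)

Lemma edge_ideal_is_ideal : is_ideal (edge_ideal D K).
Proof. exact: ideal_gen_is_ideal. Qed.

Lemma arc_edge_ideal x y : arc D x y -> edge_ideal D K ('X_x * 'X_y ^+ weight D y).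
Proof. by move=> xy; apply: mem_ideal_gen; exists x, y. Qed.

Lemma monomial_edge_ideal (m : 'X_{1..n}) x y : arc D x y ->
  (0 < m x)%N -> (weight D y <= m y)%N -> edge_ideal D K 'X_[m].
Proof.
move=> xy mx my; pose u : 'X_{1..n} := (U_(x) + U_(y) *+ weight D y)%MM.
have um : (u <= m)%MM.
  apply/mnm_lepP => i; rewrite mnmDE mulmnE !mnm1E.
  have [<-|xi] := eqVneq x i.
    by case: eqP xy => [->|]; rewrite ?arc_irreflexive ?addn0.
  by case: eqP => [<-|_]; rewrite ?mul1n.
rewrite -(submK um) mpolyXD; have [_ _ IM] := edge_ideal_is_ideal; apply: IM.
by rewrite mpolyXD -mpolyXn; apply: arc_edge_ideal.
Qed.

Lemma edge_ideal_sub_cover C : vertex_cover D C ->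
  edge_ideal D K `<=` pure_power_ideal K C (weight D).
Proof.
move=> /vertex_coverP covC.
have idC := @pure_power_ideal_is_ideal n K C (weight D).
apply: ideal_gen_sub => // _ [x [y [xy ->]]].
have mem_pow z : z \in C -> pure_power_ideal K C (weight D) ('X_z ^+ weight D z).
  by move=> zC; apply: mem_ideal_gen; exists z.
have /orP[xC|yC] := covC _ _ xy; last by case: idC => _ _; apply; apply: mem_pow.
(* A tail has weight 1, so its variable is itself a generator. *)
apply: ideal_mulr => //.
by rewrite -['X_x]expr1 -(weight_tail xy); apply: mem_pow.
Qed.

(* A monomial outside the edge ideal has exponent below the weight on a whole
   vertex cover, so it avoids the ideal of every minimal cover contained in it. *)
Lemma edge_idealE : edge_ideal D K =
  \bigcap_(C in [set C | strong_vertex_cover D C])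
     pure_power_ideal K C (weight D).
Proof.
apply/seteqP; split=> f.
  by move=> If C /andP[covC _]; apply: edge_ideal_sub_cover.
move=> capf; rewrite [f]mpolyE; have [_ _ IM] := edge_ideal_is_ideal.
apply: ideal_sum => [|m mf _]; first exact: edge_ideal_is_ideal.
rewrite -mul_mpolyC; apply: IM; apply: contrapT => mI.
have cov : vertex_cover D [set x | (m x < weight D x)%N]%SET.
  apply/vertex_coverP => x y xy; rewrite !inE (weight_tail xy) ltnS leqn0.
  apply: contra_notT mI; rewrite negb_or -lt0n -leqNgt => /andP[mx my].
  exact: monomial_edge_ideal xy mx my.
have [C strongC /fintype.subsetP Csub] := strong_cover_subset cov.
have /mem_pure_power/(_ m mf)[|i /Csub] := capf C strongC.
  exact: weight_gt0.
by rewrite inE ltnNge => /negP.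
Qed.

(** For strong [C], this monomial lies in the component of every other strong cover but not in that
    of [C]. It shows irredundance, and its annihilator modulo the edge ideal is the prime of [C]. *)
Definition cover_witness C : 'X_{1..n} :=
  [multinom if i \in C then (weight D i).-1 else weight D i | i < n].

Lemma cover_witness_other B C : strong_vertex_cover D B ->
  strong_vertex_cover D C -> B <> C ->
  pure_power_ideal K B (weight D) 'X_[cover_witness C].
Proof.
move=> strongB strongC /(strong_cover_diff strongB strongC)[x xB xC].
apply/mem_pure_power => [|m]; first exact: weight_gt0.
by rewrite msuppX inE => /eqP->; exists x; rewrite // mnmE (negbTE xC).
Qed.

Lemma cover_witnessN C : ~ pure_power_ideal K C (weight D) 'X_[cover_witness C].
Proof.
move/mem_pure_power => /(_ (@weight_gt0 _ D) (cover_witness C)).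
rewrite msuppX mem_head => /(_ isT)[i iC].
by rewrite mnmE iC leqNgt ltn_predL weight_gt0.
Qed.

Lemma variables_ideal_colon C : strong_vertex_cover D C ->
  variables_ideal K C = [set g | edge_ideal D K (g * 'X_[cover_witness C])].
Proof.
move=> strongC; rewrite edge_idealE; apply/seteqP; split=> g /= gP; last first.
  apply: contrapT => gN; apply: (@cover_witnessN C).
  by apply: pure_power_primary1 gN _; [apply: weight_gt0 | apply: gP].
move=> B strongB; have [->|/eqP neqBC] := eqVneq B C; last first.
  have [_ _ IM] := @pure_power_ideal_is_ideal n K B (weight D).
  by apply: IM; apply: cover_witness_other.
apply/mem_pure_power => [|m]; first exact: weight_gt0.
move=> /msuppM_ex[k [l []]]; rewrite msuppX inE => kg /eqP-> ->.
move/mem_variables_ideal: gP => /(_ k kg)[i iC ki]; exists i => //.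
by rewrite mnmDE mnmE iC -(prednK (weight_gt0 D i)) -add1n leq_add.
Qed.

(** An associated prime (I : f) is the intersection of the finitely many colons (I_C : f), so it
    contains one of them. As I_C is primary to P_C and omits [f], that prime is P_C. *)
Lemma associated_prime_edge_ideal p : associated_prime (edge_ideal D K) p <->
  exists2 C, strong_vertex_cover D C & p = variables_ideal K C.
Proof.
split=> [[pr_p [f pE]]|[C strongC ->]]; last first.
  split; first exact: variables_ideal_prime.
  by exists 'X_[cover_witness C]; apply: variables_ideal_colon.
have [idp p1 pM] := pr_p.
have [C [strongC colon_p]] : exists C, strong_vertex_cover D C /\
    forall g, pure_power_ideal K C (weight D) (g * f) -> p g.
  apply: contrapT => noC.
  (* Otherwise each strong cover has a multiplier outside [p] taking [f] into its component; [1] is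
     the default for other sets. The product of all these is outside [p], yet takes [f] into the
     edge ideal. *)
  have /choice[h hP] : forall C, exists g, ~ p g /\
      (strong_vertex_cover D C -> pure_power_ideal K C (weight D) (g * f)).
    move=> C; have [strongC|] := boolP (strong_vertex_cover D C); last by exists 1.
    apply: contrapT => gN; apply: noC; exists C; split=> // g gf.
    by apply: contrapT => pg; apply: gN; exists g.
  have : ~ p (\prod_C h C).
    elim/big_ind: _ => [//|g g' pg pg' /pM[]//|C _].
    by case: (hP C).
  apply; rewrite pE /= edge_idealE => C strongC.
  rewrite (bigD1 C) //= mulrAC; apply: ideal_mulr.
    exact: pure_power_ideal_is_ideal.
  by case: (hP C) => _; apply.
have fN : ~ pure_power_ideal K C (weight D) f.
  by move=> fC; apply/p1/colon_p; rewrite mul1r.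
exists C => //; apply/seteqP; split=> g.
  rewrite pE /= edge_idealE => /(_ C strongC) gf; apply: contrapT => gN.
  by apply: fN; apply: pure_power_primary1 gN gf; apply: weight_gt0.
rewrite -(radical_pure_power K C (weight_gt0 D)) => -[k gk].
apply: (prime_ideal_exp (m := k) pr_p); apply: colon_p.
by apply: ideal_mulr gk; apply: pure_power_ideal_is_ideal.
Qed.

(** * Symbolic powers and minimal primes *)

Lemma variables_idealN C x : x \notin C -> ~ variables_ideal K C 'X_x.
Proof.
move=> xC /mem_variables_ideal/(_ U_(x)%MM).
rewrite msuppX mem_head => /(_ isT)[i iC].
by rewrite mnm1E lt0b => /eqP xi; rewrite xi iC in xC.
Qed.

Lemma cover_saturation C : strong_vertex_cover D C ->
  pure_power_ideal K C (weight D) `<=`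
  [set f | exists t, ~ variables_ideal K C t /\ edge_ideal D K (t * f)].
Proof.
move=> /strong_vertex_coverP[_ nbr]; have pr := @variables_ideal_prime n K C.
apply: ideal_gen_sub; first exact: saturation_is_ideal pr edge_ideal_is_ideal.
move=> _ [x [/nbr[y yC /orP[xy|yx]] ->]]; last first.
  exists 'X_y; split; first exact: variables_idealN.
  exact: arc_edge_ideal.
(* Here [x] is a tail, so its weight is 1, and this power of the head completes ['X_x] to a
   generator of the edge ideal. *)
exists ('X_y ^+ weight D y); split.
  by move=> /(prime_ideal_exp pr); apply: variables_idealN.
by rewrite (weight_tail xy) expr1 mulrC; apply: arc_edge_ideal.
Qed.

(** Forward, I^k lies in I_C^k, and primariness of the latter cancels the multiplier [t]. Backward,
    I_C^k lies in the saturation of I^k at P_C. *)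
Lemma symbolic_power_edge_ideal k : symbolic_power (edge_ideal D K) k =
  \bigcap_(C in [set C | strong_vertex_cover D C])
     ideal_exp (pure_power_ideal K C (weight D)) k.
Proof.
have idI := ideal_exp_is_ideal (edge_ideal D K) k.
apply/seteqP; split=> f fP.
  move=> C strongC; have pr := @variables_ideal_prime n K C.
  have /fP/(localized_idealP f pr idI)[t [pt It]] :
      associated_prime (edge_ideal D K) (variables_ideal K C).
    by apply/associated_prime_edge_ideal; exists C.
  apply: (pure_power_primary (@weight_gt0 _ D) pt).
  apply: ideal_expS It; apply: edge_ideal_sub_cover.
  by case/andP: strongC.
move=> p /associated_prime_edge_ideal[C strongC ->].
have pr := @variables_ideal_prime n K C.
apply/(localized_idealP f pr idI).
exact: ideal_exp_saturation pr edge_ideal_is_ideal (cover_saturation strongC)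
  _ (fP C strongC).
Qed.

(** A prime [q] between the edge ideal and P_C omits every element outside P_C; cancelling such a
    multiplier puts the generators of I_C, hence the variables of [C], into [q]. *)
Lemma minimal_prime_edge_ideal C : strong_vertex_cover D C ->
  minimal_prime (edge_ideal D K) (variables_ideal K C).
Proof.
move=> strongC; have pr := @variables_ideal_prime n K C; split=> //.
  move=> f /(edge_ideal_sub_cover (proj1 (andP strongC))) fC.
  rewrite -(radical_pure_power K C (weight_gt0 D)).
  by exists 1%N; rewrite expr1.
move=> q pr_q Iq qC; apply/seteqP; split=> // f.
have [idq _ qM] := pr_q; apply: ideal_gen_sub f => // _ [x [xC ->]].
have /(cover_saturation strongC)[t [tC /Iq/qM[/qC//|]]] :
    pure_power_ideal K C (weight D) ('X_x ^+ weight D x).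
  by apply: mem_ideal_gen; exists x.
exact: prime_ideal_exp.
Qed.

End EdgeIdeal.

Theorem theorem3p4 (K : fieldType) (n : nat) (D : wograph n)
    (Vplus_neq0 : exists x : 'I_n, x \in Vplus D)
    (Vplus_sinks : forall x : 'I_n, x \in Vplus D -> sink D x) :
  [/\ irredundant_irreducible_decomposition (edge_ideal D K)
        [set C : {set 'I_n} | strong_vertex_cover D C]
        (fun C : {set 'I_n} => cover_ideal D K C),
      forall m : nat, (1 <= m)%N ->
        symbolic_power (edge_ideal D K) m =
        \bigcap_(C in [set C : {set 'I_n} | strong_vertex_cover D C])
          ideal_exp (cover_ideal D K C) m &
      forall C : {set 'I_n}, strong_vertex_cover D C ->
        radical (cover_ideal D K C) = variables_ideal K C /\
        minimal_prime (edge_ideal D K) (variables_ideal K C)].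
Proof.
have coverE C : cover_ideal D K C = pure_power_ideal K C (weight D).
  exact: cover_idealE.
have w_gt0 := @weight_gt0 _ D.
split.
- split=> [C strongC||C strongC].
  + by rewrite coverE; apply: pure_power_irreducible.
  + by rewrite (edge_idealE K Vplus_sinks); apply: eq_bigcapr => C _; rewrite coverE.
  (* If [C] could be dropped, its witness would lie in the edge ideal, hence in the component of
     [C]. *)
  + move=> IE; apply: (@cover_witnessN K n D C);
    suff : edge_ideal D K 'X_[cover_witness D C].
      by rewrite (edge_idealE K Vplus_sinks); apply.
    rewrite IE => B [strongB neqBC]; rewrite coverE.
    exact: cover_witness_other.
- move=> m _; rewrite symbolic_power_edge_ideal //.
  by apply: eq_bigcapr => C _; rewrite coverE.
- move=> C strongC; rewrite coverE radical_pure_power //.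
  by split=> //; apply: minimal_prime_edge_ideal.
Qed.
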